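(* Let $\mathrm{PoF}_n$ denote the price of PROP1 with respect to utilitarian welfare for allocating contiguous blocks of chores to $n$ agents. Then $\mathrm{PoF}_n=\Theta(n)$; that is, there are absolute constants $c,C>0$ such that $c\,n\le\mathrm{PoF}_n\le C n$ for every integer $n\ge 2$.
   Context: A fair-chores instance $\mathcal I=\langle N,E,\mathcal V\rangle$ consists of agents $N=\{1,\dots,n\}$, indivisible items $E=\{e_1,\dots,e_m\}$ placed on a path in this order, and for each agent $i$ an additive valuation $v_i$ (i.e. $v_i(S)=\sum_{e\in S}v_i(e)$) with $v_i(e)\le 0$ for all $e\in E$, normalized so that $v_i(\emptyset)=0$, $v_i(E)=-1$. A bundle is connected if it is a set of consecutive items (the empty set is allowed). An allocation $\mathbf A=(A_1,\dots,A_n)$ is a partition of $E$ into $n$ pairwise disjoint connected (possibly empty) bundles, $A_i$ being given to agent $i$ (the left-to-right order of the agents' bundles is arbitrary). Its utilitarian welfare is $\mathsf{UW}(\mathbf A)=\sum_{i\in N}v_i(A_i)$; $\mathsf{OPT}_U(\mathcal I)$ is the maximum of $\mathsf{UW}$ over all allocations of $\mathcal I$. An allocation $\mathbf A$ is PROP1 (proportional up to one item) if for every $i\in N$, either $v_i(A_i)\ge\frac1n v_i(E)$, or there is an item $e\in A_i$ such that $A_i\setminus\{e\}$ is connected and $v_i(A_i\setminus\{e\})\ge\frac1n v_i(E)$. The price of fairness is $\mathrm{PoF}_n=\sup_{\mathcal I}\min_{\mathbf A}\frac{\mathsf{UW}(\mathbf A)}{\mathsf{OPT}_U(\mathcal I)}$,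 the supremum over all fair-chores instances with $n$ agents (any number of items) and the minimum over all PROP1 allocations $\mathbf A$ of $\mathcal I$; conventions: $c/0=+\infty$ for $c<0$ and $0/0=1$. *)

(* Defs.v *)
From HB Require Import structures.
From mathcomp Require Import all_boot all_order all_algebra.
From mathcomp Require Import all_classical all_reals all_analysis.
Set Implicit Arguments.
Unset Strict Implicit.
Unset Printing Implicit Defensive.
Import Order.TTheory GRing.Theory Num.Theory.
Local Open Scope ring_scope.

(* The items are 'I_m, in their order on the path.  Agents and items are
   numbered from 0. *)
Definition bundle_value (R : realType) (n m : nat) (v : 'I_n -> 'I_m -> R)
    (i : 'I_n) (S : {set 'I_m}) : R :=
  \sum_(e in S) v i e.

Record instance (R : realType) (n : nat) := Instance {
  nb_items : nat;
  item_value : 'I_n -> 'I_nb_items -> R;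
  item_value_le0 : forall i e, item_value i e <= 0;
  item_value_total : forall i, bundle_value item_value i [set: 'I_nb_items]%SET = -1
}.

Notation item I := 'I_(nb_items I).

Definition value (R : realType) (n : nat) (I : instance R n) (i : 'I_n)
    (S : {set item I}) : R :=
  bundle_value (@item_value R n I) i S.

(* Taking l = r yields the empty bundle. *)
Definition contiguous (m : nat) (S : {set 'I_m}) : bool :=
  [exists l : 'I_m.+1, exists r : 'I_m.+1,
     S == [set e : 'I_m | (l <= e < r)%N]%SET].

(* The blocks of an allocation may be empty, so finset's [partition] does not
   apply. *)
Definition allocation (n m : nat) (A : {ffun 'I_n -> {set 'I_m}}) : bool :=
  [&& [forall i, contiguous (A i)],
      [forall i, forall j, (i != j) ==> [disjoint A i & A j]]
    & (\bigcup_i A i)%SET == [set: 'I_m]%SET].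

Definition welfare (R : realType) (n : nat) (I : instance R n)
    (A : {ffun 'I_n -> {set item I}}) : R :=
  \sum_i value i (A i).

(* The maximum is taken in \bar R only to have a neutral element; it is finite
   for n > 0, as allocations then exist. *)
Definition opt_welfare (R : realType) (n : nat) (I : instance R n) : R :=
  fine (\big[Order.max/-oo%E]_(A : {ffun 'I_n -> {set item I}} | allocation A)
          (welfare A)%:E).

Definition prop1 (R : realType) (n : nat) (I : instance R n)
    (A : {ffun 'I_n -> {set item I}}) : bool :=
  [forall i : 'I_n,
     (value i (A i) >= n%:R^-1 * value i [set: item I]%SET)
     || [exists e in A i,
           contiguous (A i :\ e)%SET
           && (value i (A i :\ e)%SET >= n%:R^-1 * value i [set: item I]%SET)]].

(* The ratio c / d for c, d <= 0, with 0 / 0 = 1 and c / 0 = +oo if c < 0. *)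
Definition welfare_ratio (R : realType) (c d : R) : \bar R :=
  if d == 0 then (if c == 0 then 1%E else +oo%E) else (c / d)%:E.

Definition prop1_ratio (R : realType) (n : nat) (I : instance R n) : \bar R :=
  \big[Order.min/+oo%E]_(A : {ffun 'I_n -> {set item I}}
                        | allocation A && prop1 A)
     welfare_ratio (welfare A) (opt_welfare I).

Definition price_of_prop1 (R : realType) (n : nat) : \bar R :=
  ereal_sup (range (@prop1_ratio R n)).

(* Main.v *)
Require Import Defs.
From HB Require Import structures.
From mathcomp Require Import all_boot all_order all_algebra.
From mathcomp Require Import all_classical all_reals all_analysis.
From mathcomp Require Import lra zify.
Set Implicit Arguments.
Unset Strict Implicit.
Unset Printing Implicit Defensive.
Import Order.TTheory GRing.Theory Num.Theory.
Local Open Scope ring_scope.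

(* Upper bound: whatever the instance, some PROP1 allocation costs at most 4 in
   total (costs are negated values).  As an allocation costing at most 1/n is
   PROP1, either the optimum is PROP1 itself or it costs more than 1/n, and the
   ratio is below 4n.  The allocation of cost 4 comes from a moving knife that
   gives an agent the longest next block costing some remaining agent at most
   d = 1/n, extended by the next item if this item costs the chosen agent at
   most 2d.  When the item costs more than 2d to everyone who could take the
   block, they are so much better off after it that they can skip the item as
   well as a full step.  An item that costs more than d to every remaining agent
   goes alone to the agent who minds it least; these payments sum up to at most
   the total cost 1 of the last remaining agent, the others to at most 3d each.
   Lower bound: three items cheap for agent 0 only, who may not take them all. *)

(** * Blocks of consecutive items *)

Definition segment (m p q : nat) : {set 'I_m} :=
  [set e : 'I_m | (p <= e < q)%N]%SET.

Lemma segment_all m : segment m 0 m = [set: 'I_m]%SET.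
Proof. by apply/setP => e; rewrite !inE ltn_ord. Qed.

Lemma segment0 m p : segment m p p = finset.set0.
Proof. by apply/setP => e; rewrite !inE; lia. Qed.

Lemma segment_cat m p q r : (p <= q <= r)%N ->
  segment m p r = (segment m p q :|: segment m q r)%SET.
Proof. by move=> h; apply/setP => e; rewrite !inE; lia. Qed.

Lemma segmentD1l m (e : 'I_m) q : (e < q)%N ->
  (segment m e q :\ e)%SET = segment m e.+1 q.
Proof. by move=> h; apply/setP => x; rewrite !inE -val_eqE /=; lia. Qed.

Lemma segmentD1r m (e : 'I_m) p : (p <= e)%N ->
  (segment m p e.+1 :\ e)%SET = segment m p e.
Proof. by move=> h; apply/setP => x; rewrite !inE -val_eqE /=; lia. Qed.

Lemma contiguous_segment m p q : (p <= m)%N -> (q <= m)%N ->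
  contiguous (segment m p q).
Proof.
rewrite -ltnS => pm; rewrite -ltnS => qm.
apply/existsP; exists (Ordinal pm); apply/existsP; exists (Ordinal qm).
by apply/eqP/setP => e; rewrite !inE.
Qed.

(** * Moving-knife allocation for nonnegative costs and a threshold [d] *)

Section MovingKnife.

Variables (R : realType) (n m : nat) (c : 'I_n -> 'I_m -> R) (d : R).
Hypotheses (c_ge0 : forall i e, 0 <= c i e) (d_ge0 : 0 <= d).

Local Notation C i p q := (bundle_value c i (segment m p q)).

Lemma cost_ge0 i p q : 0 <= C i p q.
Proof. exact: sumr_ge0. Qed.

Lemma cost_cat i p q r : (p <= q <= r)%N -> C i p r = C i p q + C i q r.
Proof.
move=> h; rewrite /bundle_value (big_setID (segment m p q)) /=.
by congr (_ + _); apply: eq_bigl => e; rewrite !inE; lia.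
Qed.

Lemma cost_nil i p : C i p p = 0.
Proof. by rewrite /bundle_value segment0 big_set0. Qed.

(** For negated values and [d = 1/n] this is the condition that [prop1] puts on one agent. *)
Definition up_to_one i (S : {set 'I_m}) : bool :=
  (bundle_value c i S <= d) ||
  [exists e in S, contiguous (S :\ e)%SET && (bundle_value c i (S :\ e)%SET <= d)].

Lemma up_to_one_first i p q : (p < q <= m)%N -> C i p.+1 q <= d ->
  up_to_one i (segment m p q).
Proof.
move=> /andP[pq qm] h; apply/orP; right.
have pm : (p < m)%N by lia.
apply/existsP; exists (Ordinal pm).
rewrite (@segmentD1l _ (Ordinal pm)) //= h contiguous_segment //= inE /=; lia.
Qed.

Lemma up_to_one_last i p q : (p <= q < m)%N -> C i p q <= d ->
  up_to_one i (segment m p q.+1).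
Proof.
move=> /andP[pq qm] h; apply/orP; right.
apply/existsP; exists (Ordinal qm).
rewrite (@segmentD1r _ (Ordinal qm)) //= h contiguous_segment //= ?inE /=; lia.
Qed.

(* The second alternative is a debt: such an agent hated the item [p] so much
   that it can be left out for the current step. *)
Definition affordable (t p : nat) (i : 'I_n) : Prop :=
  C i p m <= t%:R * d \/ C i p.+1 m <= (t%:R - 1) * d.

(* Payments beyond [3 * d] happen only when every remaining agent would pay at
   least as much, so that they can be charged to the last agent [l] below. *)
Lemma moving_knife_step (U : {set 'I_n}) t p :
    #|U| = t.+2 -> (p <= m)%N -> {in U, forall i, affordable t.+2 p i} ->
  exists i q, [/\ i \in U, (p <= q <= m)%N, up_to_one i (segment m p q),
    C i p q <= 3 * d \/ {in U, forall j, C i p q <= C j p q} &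
    {in (U :\ i)%SET, forall j, affordable t.+1 q j}].
Proof.
move=> cardU pm aff; have d0 := d_ge0.
have t1 : t.+1%:R = t%:R + 1 :> R by rewrite -addn1 natrD.
have t2 : t.+2%:R = t%:R + 2 :> R by rewrite -addn2 natrD.
have t0 : 0 <= t%:R :> R by [].
have td : 0 <= t%:R * d by apply: mulr_ge0.
have aff' j : j \in U -> C j p m <= t%:R * d + 2 * d \/ C j p.+1 m <= t%:R * d + d.
  move=> /aff; rewrite /affordable t2 => -[h|h]; [left|right]; nra.
have goal q j : C j q m <= t%:R * d + d \/ C j q.+1 m <= t%:R * d ->
    affordable t.+1 q j.
  rewrite /affordable t1 => -[h|h]; [left|right]; nra.
have [i0 i0U] : exists i, i \in U by apply/card_gt0P; rewrite cardU.
have [pEm|pNm] := eqVneq p m.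
  subst p; exists i0, m; split=> //.
  - by rewrite leqnn.
  - by rewrite /up_to_one cost_nil d_ge0.
  - by left; rewrite cost_nil; lra.
  - by move=> j _; apply: goal; left; rewrite cost_nil; lra.
have {pNm} pm' : (p < m)%N by lia.
(* Possible knife positions; the last one is used if there is any. *)
pose P q := [&& (p < q)%N, (q <= m)%N & [exists j in U, C j p q <= d]].
have Pm q : P q -> (q <= m)%N by case/and3P.
case: (pselect (exists q, P q)) => [exP | nP]; last first.
  have big j : j \in U -> d < C j p p.+1.
    move=> jU; rewrite ltNge; apply/negP => h; apply: nP; exists p.+1.
    rewrite /P leqnn pm' /=; apply/existsP; exists j; exact/andP.
  case: (arg_minP (fun j => C j p p.+1) i0U) => i iU imin.
  exists i, p.+1; split=> //.
  - lia.
  - apply: up_to_one_first; first lia.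
    by rewrite cost_nil.
  - by right.
  (* Without debt, [j] is relieved of more than [d]; with a debt, the item left out, [p], is now
     gone. *)
  - move=> j; rewrite !inE => /andP[_ jU]; apply: goal; left.
    have := big _ jU; have := cost_cat j (p := p) (q := p.+1) (r := m).
    rewrite leqnSn pm' => /(_ isT) e1 e2.
    by case: (aff' _ jU) => h; lra.
case: (ex_maxnP exP Pm) => q /and3P[pq qm /existsP[i /andP[iU iq]]] qmax.
have [qEm|qNm] := eqVneq q m.
  subst q; exists i, m; split=> //.
  - by rewrite pm leqnn.
  - by rewrite /up_to_one iq.
  - by left; lra.
  - by move=> j _; apply: goal; left; rewrite cost_nil; lra.
have {qNm} qm' : (q < m)%N by lia.
(* By maximality of [q], one more item is too much for everyone. *)
have big j : j \in U -> d < C j p q.+1.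
  move=> jU; rewrite ltNge; apply/negP => h.
  have := qmax q.+1; rewrite ltnn /P qm' ltnS (ltnW pq) /=.
  by move=> /(_ _)/notF; apply; apply/existsP; exists j; exact/andP.
have splits : forall j, [/\ C j p m = C j p q + C j q m, C j q m = C j q q.+1 + C j q.+1 m,
    C j p q.+1 = C j p q + C j q q.+1, C j p q = C j p p.+1 + C j p.+1 q &
    C j p.+1 m = C j p.+1 q + C j q m].
  by move=> j; split; apply: cost_cat; lia.
(* If item [q] can be added, the block costs at most [d + 2 * d], and [q] is the item to remove for
   fairness. *)
case: (pselect (exists2 i, i \in U & C i p q <= d /\ C i q q.+1 <= 2 * d)).
  move=> [i1 i1U [h1 h2]]; exists i1, q.+1; split=> //.
  - lia.
  - by apply: up_to_one_last => //; lia.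
  - by left; case: (splits i1); lra.
  - move=> j; rewrite !inE => /andP[_ jU]; apply: goal; left.
    have := big _ jU; case: (splits j) => e1 e2 e3 e4 e5.
    have := cost_ge0 j p.+1 q; have := cost_ge0 j q q.+1.
    by case: (aff' _ jU) => h; lra.
move=> nex; exists i, q; split=> //.
- lia.
- by rewrite /up_to_one iq.
- by left; lra.
- move=> j; rewrite !inE => /andP[_ jU]; apply: goal.
  have := big _ jU; case: (splits j) => e1 e2 e3 e4 e5.
  have := cost_ge0 j p.+1 q; have := cost_ge0 j p p.+1.
  have [jT | jT] := leP (C j p q) d; last first.
    by left; case: (aff' _ jU) => h; lra.
  have : 2 * d < C j q q.+1.
    by rewrite ltNge; apply/negP => h; apply: nex; exists j.
  (* A new debt, at item [q]: its cost above [2 * d] leaves at most [t * d] after it, whether or not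
     [j] had a debt at [p]. *)
  by right; case: (aff' _ jU) => h; lra.
Qed.

(** Induction on the number of remaining agents, [l] being the one served last. A payment above
    [3 * d] for the block from [p] to [q] is at most [C l p q]; as the blocks are disjoint, these
    charges add up to at most [C l p m]. *)
Lemma moving_knife t (U : {set 'I_n}) p :
    #|U| = t.+1 -> (p <= m)%N -> {in U, forall i, affordable t.+1 p i} ->
  exists (A : 'I_n -> {set 'I_m}) l, [/\ l \in U,
    {in U, forall i, contiguous (A i) /\ up_to_one i (A i)},
    {in U &, forall i j, i != j -> [disjoint A i & A j]},
    (\bigcup_(i in U) A i)%SET = segment m p m &
    \sum_(i in U) bundle_value c i (A i) <= t.+1%:R * (3 * d) + C l p m].
Proof.
elim: t U p => [|t IH] U p cardU pm aff.
  have /eqP/cards1P[i Ui] := cardU; subst U.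
  exists (fun=> segment m p m), i; split.
  - by rewrite inE.
  - move=> j; rewrite inE => /eqP ->; split; first exact: contiguous_segment.
    have [pEm|pNm] := eqVneq p m.
      by subst p; rewrite /up_to_one cost_nil d_ge0.
    (* For a single agent, a debt means that everything after [p] is free, so [p] is the item to
       remove. *)
    case: (aff i); rewrite ?inE //= ?mul1r ?subrr ?mul0r => h.
      by rewrite /up_to_one h.
    by apply: up_to_one_first; [lia | exact: le_trans h d_ge0].
  - by move=> j k; rewrite !inE => /eqP -> /eqP ->; rewrite eqxx.
  - by rewrite big_set1.
  - by rewrite big_set1; have d0 := d_ge0; lra.
have [i [q [iU /andP[pq qm] fair_i cost_i aff']]] := moving_knife_step cardU pm aff.
have cardU' : #|(U :\ i)%SET| = t.+1.
  by have := cardsD1 i U; rewrite iU cardU => -[].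
have [A [l [lU A_ok A_dis A_cov A_cost]]] := IH _ _ cardU' qm aff'.
have Asub j : j \in U -> j != i -> A j \subset segment m q m.
  by move=> jU ji; rewrite -A_cov; apply: finset.bigcup_sup; rewrite !inE ji.
have disj j : j \in U -> j != i -> [disjoint segment m p q & A j].
  move=> jU ji; rewrite disjoint_sym; apply: (disjointWl (Asub j jU ji)).
  by rewrite disjoint_subset; apply/fintype.subsetP => e; rewrite !inE; lia.
pose A' j := if j == i then segment m p q else A j.
exists A', l; rewrite /A'; split.
- by move: lU; rewrite inE => /andP[].
- move=> j jU; case: eqVneq => [->|ji].
    by split=> //; apply: contiguous_segment.
  by apply: A_ok; rewrite !inE ji.
- move=> j k jU kU; case: (eqVneq j i) => [->|ji]; case: (eqVneq k i) => [kE|ki] //.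
  + by move=> _; apply: disj.
  + by move=> _; rewrite disjoint_sym; apply: disj.
  + by apply: A_dis; rewrite !inE ?ji ?ki.
- rewrite (big_setD1 i) //= eqxx (@segment_cat _ p q m) ?pq //; congr finset.setU.
  by rewrite -A_cov; apply: eq_bigr => j; rewrite !inE => /andP[/negPf ->].
- rewrite (big_setD1 i) //= eqxx.
  have -> : \sum_(j in (U :\ i)%SET)
      bundle_value c j (if j == i then segment m p q else A j) =
      \sum_(j in (U :\ i)%SET) bundle_value c j (A j).
    by apply: eq_bigr => j; rewrite !inE => /andP[/negPf ->].
  have t1 : t.+2%:R = t.+1%:R + 1 :> R by rewrite -[t.+2]addn1 natrD.
  have -> : C l p m = C l p q + C l q m by apply: cost_cat; rewrite pq.
  have lU' : l \in U by move: lU; rewrite inE => /andP[].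
  rewrite t1 mulrDl mul1r; have d0 := d_ge0; have := cost_ge0 l p q.
  case: cost_i => [h|/(_ l lU') h]; lra.
Qed.

End MovingKnife.

(** * Upper bound on the price *)

Section Welfare.

Variables (R : realType) (n : nat) (I : instance R n).

Lemma value_le (i : 'I_n) (S T : {set item I}) : S \subset T -> value i T <= value i S.
Proof.
move=> ST; rewrite /value /bundle_value (big_setID S) /= (finset.setIidPr ST).
rewrite gerDl; apply: sumr_le0 => e _; exact: item_value_le0.
Qed.

Lemma value_le0 (i : 'I_n) (S : {set item I}) : value i S <= 0.
Proof. by apply: sumr_le0 => e _; exact: item_value_le0. Qed.

Lemma welfare_le_value (A : {ffun 'I_n -> {set item I}}) (i : 'I_n) :
  welfare A <= value i (A i).
Proof.
rewrite /welfare (bigD1 i) //= gerDl; apply: sumr_le0 => j _; exact: value_le0.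
Qed.

(** With [d = 1/n], the total cost 1 of each agent is [n * d], so all start without debt; the knife
    then costs at most [n * (3 / n) + 1 = 4]. *)
Lemma cheap_prop1_allocation : (0 < n)%N ->
  exists A : {ffun 'I_n -> {set item I}}, [/\ allocation A, prop1 A & -4 <= welfare A].
Proof.
move=> n_gt0; have n_neq0 : n%:R != 0 :> R by rewrite pnatr_eq0 -lt0n.
pose c (i : 'I_n) e := - item_value (i0 := I) i e.
have cE i (S : {set item I}) : bundle_value c i S = - value i S.
  by rewrite /value /bundle_value -sumrN.
have c_ge0 i e : 0 <= c i e by rewrite oppr_ge0 item_value_le0.
have d_ge0 : 0 <= n%:R^-1 :> R by rewrite invr_ge0.
have total (i : 'I_n) : value i [set: item I]%SET = -1 by apply: item_value_total.
have [||A [l [_ A_ok A_dis A_cov A_cost]]] :=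
  @moving_knife R n _ c n%:R^-1 c_ge0 d_ge0 n.-1 [set: 'I_n]%SET 0 _ (leq0n _).
- by rewrite cardsT card_ord prednK.
- by move=> i _; left; rewrite segment_all cE total prednK // divff ?opprK.
exists [ffun i => A i]; split.
- apply/and3P; split.
  + by apply/forallP => i; rewrite ffunE; case: (A_ok i (finset.in_setT i)).
  + apply/forallP => i; apply/forallP => j; rewrite !ffunE; apply/implyP.
    by apply: A_dis; rewrite inE.
  + rewrite -segment_all -A_cov; apply/eqP/eq_big => [i|i _]; first by rewrite inE.
    by rewrite ffunE.
- apply/forallP => i; rewrite ffunE.
  have [_] := A_ok i (finset.in_setT i).
  rewrite total mulrN1 => /orP[|/existsP[e /andP[eA /andP[e_cont e_val]]]].
    by rewrite cE lerNl => ->.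
  apply/orP; right; apply/existsP; exists e.
  by rewrite eA e_cont /= lerNl -cE.
- have -> : welfare [ffun i => A i] = - \sum_(i in [set: 'I_n]%SET) bundle_value c i (A i).
    rewrite -sumrN; apply: eq_big => [i|i _]; first by rewrite inE.
    by rewrite ffunE cE opprK.
  rewrite lerN2; apply: (le_trans A_cost).
  rewrite segment_all cE total opprK prednK // mulrCA divff //; lra.
Qed.

(** Once an allocation exists, the extended maximum is attained at a real number, which [fine]
    preserves. *)
Lemma welfare_le_opt (A : {ffun 'I_n -> {set item I}}) : allocation A ->
  welfare A <= opt_welfare I.
Proof.
move=> A_alloc.
have [B _ optE] := @eq_bigmax _ _ _ -oo%E A (@allocation n (nb_items I))
  (fun A => (welfare A)%:E) A_alloc (fun _ _ => leNye _).
by rewrite /opt_welfare optE /= -lee_fin -optE; apply: le_bigmax_cond.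
Qed.

Lemma opt_welfare_attained : (0 < n)%N ->
  exists2 A : {ffun 'I_n -> {set item I}}, allocation A & welfare A = opt_welfare I.
Proof.
move=> /cheap_prop1_allocation[A [A_alloc _ _]].
have [B B_alloc optE] := @eq_bigmax _ _ _ -oo%E A (@allocation n (nb_items I))
  (fun A => (welfare A)%:E) A_alloc (fun _ _ => leNye _).
by exists B => //; rewrite /opt_welfare optE.
Qed.

Lemma opt_welfare_le0 : (0 < n)%N -> opt_welfare I <= 0.
Proof.
move=> n_gt0; have [A _ <-] := opt_welfare_attained n_gt0.
apply: sumr_le0 => i _; exact: value_le0.
Qed.

Lemma prop1_ratio_le : (0 < n)%N -> (prop1_ratio I <= (4 * n%:R)%:E)%E.
Proof.
move=> n_gt0; have n_ge1 : 1 <= n%:R :> R by rewrite ler1n.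
have n_pos : 0 < n%:R :> R by rewrite ltr0n.
have [opt_big | opt_small] := leP (- n%:R^-1) (opt_welfare I).
  have [A A_alloc A_opt] := opt_welfare_attained n_gt0.
  apply: (@bigmin_inf _ _ _ _ A); first rewrite A_alloc /=.
    apply/forallP => i; apply/orP; left.
    have -> : value i [set: item I]%SET = -1 by apply: item_value_total.
    by rewrite mulrN1 (le_trans opt_big) // -A_opt welfare_le_value.
  (* The optimum itself is PROP1, so the ratio is 1, by the convention for [0 / 0] if it is zero. *)
  rewrite A_opt /welfare_ratio; case: eqVneq => [_|opt_neq0]; last rewrite divff //.
    by rewrite lee_fin; lra.
  by rewrite lee_fin; lra.
have [A [A_alloc A_prop1 A_cheap]] := cheap_prop1_allocation n_gt0.
have opt_lt0 : opt_welfare I < 0 by rewrite (lt_trans opt_small) // oppr_lt0 invr_gt0.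
apply: (@bigmin_inf _ _ _ _ A); first by rewrite A_alloc.
rewrite /welfare_ratio lt_eqF // lee_fin ler_ndivrMr //.
apply: le_trans A_cheap; rewrite -mulrA.
have : n%:R * opt_welfare I <= -1.
  by rewrite mulrC -ler_pdivlMr // mulN1r ltW.
lra.
Qed.

End Welfare.

(** * Lower bound on the price *)

Section HardInstance.

Variables (R : realType) (k : nat).
Local Notation n := k.+2.

(* Only agent 0 minds item 3, and the others mind items 0, 1, 2 far more than
   agent 0 does; but taking all three of them violates PROP1 for agent 0. *)
Definition hard_value (i : 'I_n) (e : 'I_4) : R :=
  if i == ord0 then (if (e < 3)%N then - (2 / 3) / n%:R else 2 / n%:R - 1)
  else (if (e < 3)%N then - 3^-1 else 0).

(** The upper bound makes the value [2 / n - 1] of item 3 nonpositive. *)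
Lemma invn_bounds : 0 < (n%:R^-1 : R) <= 2^-1.
Proof. by rewrite invr_gt0 ltr0n lef_pV2 ?posrE ?ltr0n // ler_nat. Qed.

Lemma hard_value_le0 i e : hard_value i e <= 0.
Proof.
have := invn_bounds; rewrite /hard_value; move: (n%:R^-1 : R) => x.
by case: ifP => _; case: ifP => _ /andP[h1 h2]; lra.
Qed.

Lemma hard_value_total i : bundle_value hard_value i [set: 'I_4]%SET = -1.
Proof.
rewrite /bundle_value (eq_bigl xpredT) => [|e]; last by rewrite inE.
rewrite !big_ord_recl big_ord0 /hard_value /=.
by move: (n%:R^-1 : R) => x; case: ifP => _; lra.
Qed.

Definition hard_instance : instance R n := Instance hard_value_le0 hard_value_total.

Lemma hard_opt_welfare : - (2 / n%:R) <= opt_welfare hard_instance.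
Proof.
(* Agent 0 pays [2 / n] for the first three items; agent 1 takes item 3 for free. *)
pose B (i : 'I_n) : {set 'I_4} :=
  if i == ord0 then segment 4 0 3
  else if i == inord 1 then segment 4 3 4 else segment 4 0 0.
have alloc : allocation [ffun i => B i].
  apply/and3P; split.
  - apply/forallP => i; rewrite ffunE /B.
    by case: ifP => _; [|case: ifP => _]; apply: contiguous_segment.
  - apply/forallP => i; apply/forallP => j; rewrite !ffunE; apply/implyP => /eqP ij.
    rewrite disjoint_subset; apply/fintype.subsetP => e; rewrite /B.
    case: (i =P ord0) => ?; case: (j =P ord0) => ?; case: (i =P inord 1) => ?;
      case: (j =P inord 1) => ?; rewrite !inE; first [lia | congruence].
  - apply/eqP/setP => e; rewrite inE; apply/finset.bigcupP.
    have [e3|e3] := ltnP e 3; [exists ord0 | exists (inord 1)] => //; rewrite ffunE /B.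
      by rewrite inE e3.
    by rewrite -val_eqE /= inordK //= eqxx inE e3 /=.
apply: le_trans (@welfare_le_opt _ _ hard_instance _ alloc).
rewrite /welfare (bigD1 ord0) //= big1 ?addr0 => [|i i0]; rewrite ffunE /B ?eqxx.
  rewrite /value /bundle_value big_mkcond /= !big_ord_recl big_ord0 !inE /=.
  by rewrite /hard_value /=; move: (n%:R^-1 : R) => x; lra.
rewrite (negPf i0); apply: big1 => e; case: ifP => _; rewrite inE; last lia.
by rewrite /= /hard_value (negPf i0) => /andP[e3 _]; rewrite ltnNge e3.
Qed.

(** Another agent must take one of the first three items, at cost [1 / 3]: otherwise agent 0 keeps
    two of them after any removal, at cost [4 / (3 * n) > 1 / n]. *)
Lemma hard_prop1_welfare (A : {ffun 'I_n -> {set item hard_instance}}) :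
  allocation A -> prop1 A -> welfare A <= - 3^-1.
Proof.
move=> /and3P[_ _ /eqP A_cov] /forallP/(_ ord0) A0.
have [/existsP[e /andP[e3 eA]] | no_e] :=
    boolP [exists e : 'I_4, (e < 3)%N && (e \notin A ord0)].
  have : e \in (\bigcup_i A i)%SET by rewrite A_cov inE.
  case/finset.bigcupP => j _ ej.
  apply: (le_trans (welfare_le_value A j)).
  apply: (le_trans (@value_le _ _ hard_instance j [set e]%SET (A j) _)).
    by apply/fintype.subsetP => x; rewrite inE => /eqP ->.
  rewrite /value /bundle_value big_set1 /= /hard_value e3.
  by case: eqVneq ej eA => [-> ->|].
have inA (e : 'I_4) : (e < 3)%N -> e \in A ord0.
  by move=> e3; move/existsPn/(_ e): no_e; rewrite e3 negbK.
have two (S : {set item hard_instance}) (x y : 'I_4) :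
    (x < 3)%N -> (y < 3)%N -> x != y -> x \in S -> y \in S ->
    value ord0 S < - n%:R^-1.
  move=> x3 y3 xy xS yS.
  apply: (le_lt_trans (@value_le _ _ hard_instance ord0 [set x; y]%SET S _)).
    by apply/fintype.subsetP => z; rewrite !inE => /orP[] /eqP ->.
  rewrite /value /bundle_value big_setU1 ?inE //= big_set1 /hard_value /= x3 y3.
  by have := invn_bounds; move: (n%:R^-1 : R) => r /andP[]; lra.
have total : value ord0 [set: item hard_instance]%SET = -1 by apply: item_value_total.
pose x0 : 'I_4 := inord 0; pose x1 : 'I_4 := inord 1; pose x2 : 'I_4 := inord 2.
have [v0 v1 v2] : [/\ val x0 = 0, val x1 = 1 & val x2 = 2]%N by rewrite /= !inordK.
move: A0; rewrite total mulrN1 leNgt (two _ x0 x1) ?inA -?val_eqE /= ?v0 ?v1 //=.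
case/existsP => e /and3P[_ _]; rewrite leNgt => /negP[].
have [e0|e0] := eqVneq (val e) 0%N.
  by apply: (two _ x1 x2); rewrite ?inE ?inA -?val_eqE /= ?v1 ?v2 ?e0.
have [e1|e1] := eqVneq (val e) 1%N.
  by apply: (two _ x0 x2); rewrite ?inE ?inA -?val_eqE /= ?v0 ?v2 ?e1.
(* This covers the removal of item 2 and of item 3. *)
by apply: (two _ x0 x1); rewrite ?inE ?inA -?val_eqE /= ?v0 ?v1 ?andbT // eq_sym.
Qed.

(** The quotient of [1 / 3] by [2 / n] is [n / 6]. A zero optimum would make the ratio infinite. *)
Lemma hard_prop1_ratio : ((6^-1 * n%:R)%:E <= prop1_ratio hard_instance)%E.
Proof.
apply: le_bigmin; first exact: leey.
move=> A /andP[A_alloc A_prop1]; rewrite /welfare_ratio.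
have A_low := hard_prop1_welfare A_alloc A_prop1.
have opt_high := hard_opt_welfare.
have opt_le0 := opt_welfare_le0 hard_instance (ltn0Sn _).
have [opt0|opt_neq0] := eqVneq (opt_welfare hard_instance) 0.
  by case: eqVneq => [A0|_]; [exfalso; lra | exact: leey].
have opt_lt0 : opt_welfare hard_instance < 0 by rewrite lt_neqAle opt_neq0.
have n_pos : 0 < n%:R :> R by rewrite ltr0n.
rewrite lee_fin ler_ndivlMr //; apply: (le_trans A_low).
have : n%:R * - (2 / n%:R) <= n%:R * opt_welfare hard_instance by rewrite ler_pM2l.
rewrite mulrN mulrCA divff ?gt_eqF // -mulrA; lra.
Qed.

End HardInstance.

Theorem theorem21 (R : realType) :
  exists c C : R, [/\ 0 < c, 0 < C &
    forall n : nat, (2 <= n)%N ->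
      ((c * n%:R)%:E <= price_of_prop1 R n)%E /\
      (price_of_prop1 R n <= (C * n%:R)%:E)%E].
Proof.
exists 6^-1, 4; split; rewrite ?invr_gt0 // => -[|[|k]] // _; split.
  apply: le_trans (hard_prop1_ratio R k) _.
  by apply: ereal_sup_ubound; exists (hard_instance R k).
by apply: ge_ereal_sup => _ [I _ <-]; apply: prop1_ratio_le.
Qed.
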